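(* Let $(E,f,S)$ be an almost entropic partial Dowling geometry of rank $4$ and let $s,s'\in S$. If $t,t'\in S$ are both geometric products of $s,s'$, then $f(t_{i,j},t'_{i,j})=1$ for all distinct $1\le i,j\le4$. Conversely, if $t\in S$ is a geometric product of $s,s'$, $t'\in S$, and $f(t_{i,j},t'_{i,j})=1$ for some distinct $1\le i,j\le4$, then $t'$ is also a geometric product of $s,s'$; in particular $f(t_{k,l},t'_{k,l})=1$ for all distinct $1\le k,l\le4$.
   Context: A polymatroid is $(E,f)$ with $f:\mathcal{P}(E)\to\mathbb{R}$, $f(\emptyset)=0$, monotone, submodular (and of finite type, $f(S)=\sup_{F\subseteq S\text{ finite}}f(F)$, if $E$ is infinite); $f(a_1,\dots,a_k):=f(\{a_1,\dots,a_k\})$ and $\mathrm{cl}(A)=\{x\in E\mid f(A\cup\{x\})=f(A)\}$. A polymatroid is entropic if $f(S)=H((X_i)_{i\in S})$ for random variables $(X_i)_{i\in E}$ on a finite probability space (Shannon entropy), and almost entropic if it is of finite type and a pointwise limit of entropic polymatroids on $E$. A partial Dowling geometry (PDG) of rank $r$ is a triple $(E,f,S)$ where $(E,f)$ is a polymatroid and: (1) $S$ is a set with an involution $s\mapsto s^{-1}$ and a distinguished element $e$ with $e^{-1}=e$; (2) $E$ contains $B=\{b_1,\ldots,b_r\}$ with $f(A)=|A|$ for all $A\subseteq B$; (3) for each $1\le i<j\le r$, $E$ contains a copy $\{s_{i,j}\mid s\in S\}$ of $S$, these copies pairwise disjoint and disjoint from $B$, and $E=B\sqcup\bigsqcup_{i<j}\{s_{i,j}\mid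 s\in S\}$; one sets $s_{i,j}^{-1}:=(s^{-1})_{i,j}$, and for $i<j$, $s_{j,i}:=s_{i,j}^{-1}$ and $s_{j,i}^{-1}:=s_{i,j}$; (4) $s_{i,j}\in\mathrm{cl}(b_i,b_j)$ for all distinct $i,j$; (5) $f(s_{i,j})=1$ and $f(b_i,s_{i,j})=2$ for all $s\in S$ and distinct $i,j$; (6) $f(s_{i,j},s^{-1}_{j,k},e_{k,i})=2$ for all $s\in S$ and distinct $i,j,k$. The PDG is almost entropic if $(E,f)$ is. A relator is a triple $(s,s',s'')\in S^3$ with $f(s_{i,j},s'_{j,k},s''_{k,i})=2$ for all pairwise distinct $i,j,k$. A geometric product of $s,s'\in S$ is an element $t\in S$ such that $(s,s',t^{-1})$ is a relator. *)

(* Defs.v *)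
From HB Require Import structures.
From mathcomp Require Import all_boot all_order all_algebra.
From mathcomp Require Import all_classical all_reals all_analysis.

Set Implicit Arguments.
Unset Strict Implicit.
Unset Printing Implicit Defensive.

Import Order.TTheory GRing.Theory Num.Theory.
Import numFieldNormedType.Exports.

Local Open Scope classical_set_scope.
Local Open Scope ring_scope.

Definition finite_type (R : realType) (E : Type) (f : set E -> R) : Prop :=
  forall A : set E,
    f A = sup [set f F | F in [set F : set E | finite_set F /\ F `<=` A]].

Record polymatroid (R : realType) (E : Type) (f : set E -> R) : Prop :=
  Polymatroid {
    polymatroid0 : f set0 = 0;
    polymatroid_mono : forall A B : set E, A `<=` B -> f A <= f B;
    polymatroid_submod : forall A B : set E,
      f (A `|` B) + f (A `&` B) <= f A + f B;
    polymatroid_ftype : infinite_set [set: E] -> finite_type f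
  }.

Definition cl (R : realType) (E : Type) (f : set E -> R) (A : set E) : set E :=
  [set x | f (A `|` [set x]) = f A].

Record finprob (R : realType) (Omega : finType) := FinProb {
  pmf :> Omega -> R;
  pmf_ge0 : forall w, 0 <= pmf w;
  pmf_sum1 : \sum_(w : Omega) pmf w = 1
}.

Definition prob_eq (R : realType) (Omega : finType) (P : finprob R Omega)
    (T : choiceType) (Y : Omega -> T) (y : T) : R :=
  \sum_(w : Omega | Y w == y) P w.

(* [ln 0 = 0], so values of probability 0 contribute nothing.  The natural
   logarithm is used; the base is immaterial for almost entropicity, because
   the pointwise limits of entropy functions are stable under positive
   rescaling. *)
Definition entropy (R : realType) (Omega : finType) (P : finprob R Omega)
    (T : choiceType) (Y : Omega -> T) : R :=
  - \sum_(y \in range Y) prob_eq P Y y * ln (prob_eq P Y y).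

(* The random variable (X_i)_{i in A}; its values are the functions on the
   subtype of elements of A (a [choiceType], classically), so A may be
   infinite. *)
Definition joint (E : Type) (Omega : finType) (V : E -> choiceType)
    (X : forall i : E, Omega -> V i) (A : set E) :
    Omega -> (forall i : {i : E | A i}, V (sval i)) :=
  fun w i => X (sval i) w.

Definition entropic (R : realType) (E : Type) (f : set E -> R) : Prop :=
  exists (Omega : finType) (P : finprob R Omega)
         (V : E -> choiceType) (X : forall i : E, Omega -> V i),
    forall A : set E, f A = entropy P (@joint E Omega V X A).

Definition almost_entropic (R : realType) (E : Type) (f : set E -> R) : Prop :=
  finite_type f /\
  exists g : nat -> set E -> R,
    (forall n, polymatroid (g n) /\ entropic (g n)) /\
    (forall A : set E, g n A @[n --> \oo] --> f A).

(* [c i j s] is the element s_{i,j} for i < j, and is irrelevant otherwise;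
   the remaining elements are s_{j,i} := (s^-1)_{i,j} for i < j. *)
Definition label (r : nat) (E S : Type) (inv : S -> S)
    (c : 'I_r -> 'I_r -> S -> E) (s : S) (i j : 'I_r) : E :=
  if (i < j)%N then c i j s else c j i (inv s).

(* With [label] as above, s_{i,j}^-1 is [label inv c (inv s) i j] for all
   distinct i, j: for i < j, s_{j,i}^-1 = s_{i,j} because [inv] is an
   involution. *)
Record pdg (R : realType) (r : nat) (E S : Type) := PDG {
  pdg_f : set E -> R;
  pdg_inv : S -> S;
  pdg_e : S;
  pdg_b : 'I_r -> E;
  pdg_c : 'I_r -> 'I_r -> S -> E;
  pdg_polymatroid : polymatroid pdg_f;
  pdg_invK : involutive pdg_inv;
  pdg_inve : pdg_inv pdg_e = pdg_e;
  pdg_b_inj : injective pdg_b;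
  pdg_f_b : forall A : {set 'I_r}, pdg_f (pdg_b @` [set` A]) = #|A|%:R;
  pdg_c_inj : forall (i j k l : 'I_r) (s t : S), (i < j)%N -> (k < l)%N ->
    pdg_c i j s = pdg_c k l t -> [/\ i = k, j = l & s = t];
  pdg_b_c : forall (i j k : 'I_r) (s : S), (j < k)%N ->
    pdg_b i <> pdg_c j k s;
  pdg_cover : forall x : E,
    (exists i, x = pdg_b i) \/
    (exists (i j : 'I_r) (s : S), (i < j)%N /\ x = pdg_c i j s);
  pdg_cl : forall (s : S) (i j : 'I_r), i != j ->
    cl pdg_f [set pdg_b i; pdg_b j] (label pdg_inv pdg_c s i j);
  pdg_f1 : forall (s : S) (i j : 'I_r), i != j ->
    pdg_f [set label pdg_inv pdg_c s i j] = 1;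
  pdg_f2 : forall (s : S) (i j : 'I_r), i != j ->
    pdg_f [set pdg_b i; label pdg_inv pdg_c s i j] = 2;
  pdg_f3 : forall (s : S) (i j k : 'I_r), i != j -> j != k -> k != i ->
    pdg_f [set label pdg_inv pdg_c s i j;
               label pdg_inv pdg_c (pdg_inv s) j k;
               label pdg_inv pdg_c pdg_e k i] = 2
}.

Definition elt (R : realType) (r : nat) (E S : Type) (G : pdg R r E S)
    (s : S) (i j : 'I_r) : E :=
  label (pdg_inv G) (pdg_c G) s i j.

Definition relator (R : realType) (r : nat) (E S : Type) (G : pdg R r E S)
    (s s' s'' : S) : Prop :=
  forall i j k : 'I_r, i != j -> j != k -> k != i ->
    pdg_f G [set elt G s i j; elt G s' j k; elt G s'' k i] = 2.

Definition geometric_product (R : realType) (r : nat) (E S : Type)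
    (G : pdg R r E S) (s s' t : S) : Prop :=
  relator G s s' (pdg_inv G t).

(* Main.v *)
Require Import Defs.
From mathcomp Require Import all_boot all_order all_algebra.
From mathcomp Require Import all_classical all_reals all_analysis.
From mathcomp Require Import lra.

Import Order.TTheory GRing.Theory Num.Theory.

Local Open Scope classical_set_scope.
Local Open Scope ring_scope.

(** The elements [t_{i,k}] and [t'_{i,k}] both lie on the two lines spanned by
    [b_i, b_k] and by [s_{i,j}, s'_{j,k}].  These lines span rank 3 together, so
    submodularity forces their intersection to have rank at most 1.  For the
    converse, axiom (6) projects [t_{i,j}] from [e_{k,i}] to [t_{k,j}], and the
    same argument on two lines shows that this projection preserves
    parallelism; such projections connect all ordered pairs of indices. *)

Section PolymatroidTheory.
Local Set Implicit Arguments.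
Local Unset Strict Implicit.
Variables (R : realType) (E : Type) (f : set E -> R).
Hypothesis pf : polymatroid f.
Implicit Types (A B C : set E) (x y u v : E).

Let mono := polymatroid_mono pf.

(** Submodularity for [A] with [x] added and for [B]: the intersection contains [A], so the equal
    ranks of [A] with and without [x] cancel. The free set [C] allows use on explicitly listed sets
    without reordering them. *)
Lemma rank_le_cl A B C x :
  cl f A x -> A `<=` B -> C `<=` B `|` [set x] -> f C <= f B.
Proof.
rewrite /cl /= => clx AB CBx.
have sub := polymatroid_submod pf (A `|` [set x]) B.
have leU : f C <= f ((A `|` [set x]) `|` B).
  by apply: mono => y /CBx [|]; [right | left; right].
have leI : f A <= f ((A `|` [set x]) `&` B).
  by apply: mono => y Ay; split; [left | apply: AB].
lra.
Qed.

Lemma rank_setU_le A B : f (A `|` B) <= f A + f B.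
Proof.
have sub := polymatroid_submod pf A B.
have := mono (@sub0set _ (A `&` B)); rewrite (polymatroid0 pf).
lra.
Qed.

Definition parallel u v : Prop :=
  [/\ f [set u] = 1, f [set v] = 1 & f [set u; v] = 1].

Lemma parallel_sym u v : parallel u v -> parallel v u.
Proof. by case=> fu fv fuv; split; rewrite // setUC. Qed.

Lemma parallel_rank_le A u v :
  parallel u v -> f (A `|` [set v]) <= f (A `|` [set u]).
Proof.
case=> fu _ fuv.
have clv : cl f [set u] v by rewrite /cl /= fuv fu.
by apply: (rank_le_cl clv) => y /=; [right | case; [left; left | right]].
Qed.

Lemma parallel_rank A u v :
  parallel u v -> f (A `|` [set u]) = f (A `|` [set v]).
Proof.
move=> puv; apply/eqP; rewrite eq_le; apply/andP.
by split; apply: parallel_rank_le; first exact: parallel_sym.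
Qed.

(** Both lines keep rank 2 after [u] and [v] are added to them; only then is the pair sure to lie in
    the intersection, whose rank is at most 2 + 2 - 3. *)
Lemma coplanar_lines_meet (x y x' y' u v : E) :
  f [set x; y] = 2 -> f [set x'; y'] = 2 -> 3 <= f [set x; y; x'] ->
  cl f [set x; y] u -> cl f [set x; y] v ->
  cl f [set x'; y'] u -> cl f [set x'; y'] v -> f [set u; v] <= 1.
Proof.
move=> fxy fxy' ge3 xyu xyv xyu' xyv'.
have rank_cl2 (a b : E) : cl f [set a; b] u -> cl f [set a; b] v ->
    f ([set a; b] `|` [set u; v]) <= f [set a; b].
  move=> abu; rewrite /cl /= => <-.
  by apply: (rank_le_cl abu) => w /=; tauto.
have := rank_cl2 _ _ xyu xyv; have := rank_cl2 _ _ xyu' xyv'.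
set A := [set x; y] `|` _; set B := [set x'; y'] `|` _ => leB leA.
have sub := polymatroid_submod pf A B.
have leU : f [set x; y; x'] <= f (A `|` B).
  by apply: mono => w; rewrite /A /B /=; tauto.
have leI : f [set u; v] <= f (A `&` B).
  by apply: mono => w; rewrite /A /B /=; tauto.
lra.
Qed.

End PolymatroidTheory.

Lemma exists_third_ord {r : nat} (i j : 'I_r) :
  (2 < r)%N -> exists k : 'I_r, k != i /\ k != j.
Proof.
move=> r3; have : (0 < #|~: [set i; j]%SET|)%N.
  rewrite cardsCs finset.setCK cards2 card_ord subn_gt0.
  by apply: leq_trans r3; case: (_ != _).
by case/card_gt0P => k; rewrite !inE negb_or => /andP[ki kj]; exists k.
Qed.

Section DowlingTheory.
Local Set Implicit Arguments.
Local Unset Strict Implicit.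
Variables (R : realType) (r : nat) (E S : Type) (G : pdg R r E S).
Implicit Types (s t a : S) (i j k : 'I_r).

Local Notation f := (pdg_f G).
Local Notation b := (pdg_b G).
Local Notation inv := (pdg_inv G).
Local Notation elt := (elt G).
Let pf := pdg_polymatroid G.

Lemma elt_inv s i j : i != j -> elt (inv s) j i = elt s i j.
Proof.
rewrite /Defs.elt /label neq_ltn => /orP[] h; last by rewrite h ltnNge ltnW.
by rewrite h ltnNge (ltnW h) /= pdg_invK.
Qed.

Lemma rank_b i : f [set b i] = 1.
Proof.
rewrite -[RHS]/(1%:R) -(cards1 i) -(pdg_f_b G); congr (f _).
apply/seteqP; split => [x ->|x [y]] /=; last by rewrite inE => /eqP -> <-.
by exists i; rewrite //= inE.
Qed.

Lemma rank_bb i j : i != j -> f [set b i; b j] = 2.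
Proof.
move=> ij; have <- : #|[set i; j]%SET| = 2%N by rewrite cards2 ij.
rewrite -(pdg_f_b G); congr (f _); apply/seteqP; split => [x|x [y]] /=.
  by case=> ->; [exists i | exists j]; rewrite //= !inE eqxx ?orbT.
by rewrite !inE => /orP[] /eqP -> <-; [left | right].
Qed.

Lemma rank_bbb i j k : i != j -> j != k -> k != i -> f [set b i; b j; b k] = 3.
Proof.
move=> ij jk ki; have <- : #|[set i; j; k]%SET| = 3%N.
  by rewrite -finset.setUA cardsU1 cards2 jk !inE (negPf ij) eq_sym (negPf ki).
rewrite -(pdg_f_b G); congr (f _); apply/seteqP; split => [x|x [y]] /=.
  by case=> [[]|] ->; [exists i | exists j | exists k];
    rewrite //= !inE eqxx ?orbT.
by rewrite !inE => /orP[/orP[]|] /eqP -> <-; [left; left | left; right | right].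
Qed.

(** The three points have rank 2 by axiom (4), and axiom (5) already gives rank 2 without [b j]. *)
Lemma cl_b_elt s i j : i != j -> cl f [set b i; elt s i j] (b j).
Proof.
move=> ij; have := pdg_cl G s ij; rewrite /cl /= (pdg_f2 G s ij).
by rewrite rank_bb // => <-; congr (f _); apply/seteqP; split=> x /=; tauto.
Qed.

Lemma rank_b_elt_elt s t i j k : i != j -> j != k -> k != i ->
  3 <= f [set b i; elt s i j; elt t j k].
Proof.
move=> ij jk ki; rewrite -(rank_bbb ij jk ki).
(* The set generates [b j] from [b i] and [elt s i j], and then [b k] from [b j] and [elt t j k]. *)
apply: (@le_trans _ _ (f [set b i; elt s i j; elt t j k; b j])).
  by apply: (rank_le_cl pf (cl_b_elt t jk)) => x /=; tauto.
by apply: (rank_le_cl pf (cl_b_elt s ij)) => x /=; tauto.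
Qed.

Lemma rank_b_b_elt s i j k : i != j -> j != k -> k != i ->
  3 <= f [set b i; b k; elt s i j].
Proof.
move=> ij jk ki; rewrite -(rank_bbb ij jk ki).
by apply: (rank_le_cl pf (cl_b_elt s ij)) => x /=; tauto.
Qed.

Lemma rank_elt_elt s t i j k : i != j -> j != k -> k != i ->
  f [set elt s i j; elt t j k] = 2.
Proof.
move=> ij jk ki; have ge3 := rank_b_elt_elt s t ij jk ki.
have le2 := rank_setU_le pf [set elt s i j] [set elt t j k].
(* Lower bound: adding [b i], of rank 1, brings the rank to at least 3. *)
have le3 := rank_setU_le pf [set b i] [set elt s i j; elt t j k].
have := pdg_f1 G s ij; have := pdg_f1 G t jk; have := rank_b i.
rewrite setUA in le3; rewrite -![label _ _ _ _ _]/(elt _ _ _) => *.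
lra.
Qed.

Definition elt_parallel t t' i j : Prop :=
  parallel f (elt t i j) (elt t' i j).

Lemma elt_parallelP t t' i j : i != j ->
  f [set elt t i j; elt t' i j] = 1 -> elt_parallel t t' i j.
Proof. by move=> ij ?; split=> //; apply: pdg_f1. Qed.

Lemma elt_parallel_inv t t' i j : i != j ->
  elt_parallel t t' i j -> elt_parallel (inv t) (inv t') j i.
Proof. by move=> ij; rewrite /elt_parallel !elt_inv. Qed.

Lemma elt_parallel_of_line s s' t t' i j k : i != j -> j != k -> k != i ->
  f [set elt s i j; elt s' j k; elt t i k] = 2 ->
  f [set elt s i j; elt s' j k; elt t' i k] = 2 -> elt_parallel t t' i k.
Proof.
move=> ij jk ki ft ft'; have ik : i != k by rewrite eq_sym.
have fl := rank_elt_elt s s' ij jk ki.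
apply: elt_parallelP => //; apply/eqP; rewrite eq_le; apply/andP; split.
  (* The point [elt s i j] of the second line lies off the line through [b i] and [b k], so the two
     lines together have rank at least 3. *)
  apply: (coplanar_lines_meet pf (rank_bb ik) fl
    (rank_b_b_elt s ij jk ki)); try exact: pdg_cl.
    by rewrite /cl /= fl.
  by rewrite /cl /= fl.
rewrite -(pdg_f1 G t ik).
by apply: (polymatroid_mono pf) => x /= ->; left.
Qed.

Lemma elt_parallel_left t t' i j k : i != j -> j != k -> k != i ->
  elt_parallel t t' i j -> elt_parallel t t' k j.
Proof.
move=> ij jk ki par_ij; have kj : k != j by rewrite eq_sym.
(* Axiom (6), with the inverse at [j k] read as [elt s k j]. *)
have fline (s : S) :
    f ([set elt (pdg_e G) k i; elt s k j] `|` [set elt s i j]) = 2.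
  rewrite -(pdg_f3 G s ij jk ki); congr (f _).
  rewrite -![label _ _ _ _ _]/(elt _ _ _) elt_inv //.
  by apply/seteqP; split=> x /=; tauto.
apply: (@elt_parallel_of_line (pdg_e G) t t t' k i j) => //.
  by rewrite setUAC.
(* Replacing [elt t i j] by the parallel [elt t' i j] turns the claim into [fline t'], so both
   targets lie on one line. *)
by rewrite setUAC (parallel_rank pf _ par_ij).
Qed.

(** Inversion swaps the two indices, which reduces a change of the second index to a change of the
    first. *)
Lemma elt_parallel_right t t' i j k : i != j -> j != k -> k != i ->
  elt_parallel t t' i j -> elt_parallel t t' i k.
Proof.
move=> ij jk ki /(elt_parallel_inv ij) par_ji.
rewrite -(pdg_invK G t) -(pdg_invK G t'); apply: elt_parallel_inv => //.
by apply: (@elt_parallel_left _ _ j i k) par_ji; rewrite // eq_sym.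
Qed.

Lemma elt_parallel_all t t' i j k l : (2 < r)%N -> i != j -> k != l ->
  elt_parallel t t' i j -> elt_parallel t t' k l.
Proof.
move=> r3 ij kl par_ij.
have moveL x y z : x != y -> z != y ->
    elt_parallel t t' x y -> elt_parallel t t' z y.
  move=> xy zy; have [->//|zx] := eqVneq z x.
  by apply: elt_parallel_left; rewrite // eq_sym.
have moveR x y z : x != y -> x != z ->
    elt_parallel t t' x y -> elt_parallel t t' x z.
  move=> xy xz; have [->//|zy] := eqVneq z y.
  by apply: elt_parallel_right; rewrite // eq_sym.
(* The route is (i,j), (m,j), (m,l), (k,l); avoiding [j] and [l] keeps each pair distinct. *)
have [m [mj ml]] := exists_third_ord j l r3.
by apply: (moveL m) => //; apply: (moveR m j) => //; apply: (moveL i).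
Qed.

Lemma geometric_product_unique s s' t t' i j : (2 < r)%N -> i != j ->
  geometric_product G s s' t -> geometric_product G s s' t' ->
  elt_parallel t t' i j.
Proof.
move=> r3 ij gt gt'; have [k [ki kj]] := exists_third_ord i j r3.
have ik : i != k by rewrite eq_sym.
have ji : j != i by rewrite eq_sym.
(* The extra index goes in the middle, so the inverse at [j i] in each relator becomes [elt t i j]
   or [elt t' i j]. *)
have := gt' i k j ik kj ji; have := gt i k j ik kj ji.
by rewrite !elt_inv //; apply: elt_parallel_of_line.
Qed.

Lemma geometric_product_parallel s s' t t' :
  (forall i j, i != j -> elt_parallel t t' i j) ->
  geometric_product G s s' t -> geometric_product G s s' t'.
Proof.
move=> par gt i j k ij jk ki; have ik : i != k by rewrite eq_sym.
have := gt i j k ij jk ki; rewrite !elt_inv // => <-.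
by rewrite (parallel_rank pf _ (par i k ik)).
Qed.

End DowlingTheory.

Theorem theorem5p5 (R : realType) (E S : Type) (G : pdg R 4 E S)
    (hG : almost_entropic (pdg_f G)) (s s' : S) :
  (forall t t' : S, geometric_product G s s' t -> geometric_product G s s' t' ->
     forall i j : 'I_4, i != j -> pdg_f G [set elt G t i j; elt G t' i j] = 1)
  /\
  (forall t t' : S, geometric_product G s s' t ->
     (exists i j : 'I_4, i != j /\ pdg_f G [set elt G t i j; elt G t' i j] = 1) ->
     geometric_product G s s' t' /\
     (forall k l : 'I_4, k != l -> pdg_f G [set elt G t k l; elt G t' k l] = 1)).
Proof.
split=> [t t' gt gt' i j ij|t t' gt [i [j [ij ftt']]]].
  by have [] := geometric_product_unique (isT : (2 < 4)%N) ij gt gt'.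
have par k l : k != l -> elt_parallel G t t' k l.
  move=> kl; apply: (@elt_parallel_all _ _ _ _ _ _ _ i j) => //.
  exact: elt_parallelP.
split=> [|k l kl]; last by have [] := par k l kl.
exact: geometric_product_parallel gt.
Qed.
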